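(* Let $f: M\to\mathbb{R}^3$ be a CMC surface with $H=1$ (not a round sphere), with Gauss map $N$ and parallel CMC surface $g=f+N$, and let $d_\varrho$ be the isothermic family of flat connections formed with the dual surface $g$. Let $\varrho\in\mathbb{C}\setminus\{0,1\}$. Then all $d_\varrho$-parallel sections on $\tilde M$ are given algebraically by $d^N_\mu$-parallel sections. More precisely, put $a=1-2\varrho$, $b=2\sqrt{\varrho(1-\varrho)}$ (for either choice of the square root) and $\mu_\pm=a\pm ib$. Then any $d_\varrho$-parallel section $\phi$ is given as $$\phi=\phi_++\phi_-,\qquad \phi_\pm=\begin{pmatrix}\alpha_\pm\\ \beta_\pm\end{pmatrix},$$ where $$d^N_{\mu_\pm}\alpha_\pm=0,\qquad \beta_\pm=\tfrac12\big(N\alpha_\pm(a-1)\pm\alpha_\pm b\big).$$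
   Context: $\mathbb{H}=\mathrm{span}_{\mathbb{R}}\{1,i,j,k\}=\mathbb{R}^4$ are the quaternions, $\mathbb{R}^3=\mathrm{Im}\,\mathbb{H}$, $S^2=\{n\in \mathrm{Im}\,\mathbb{H}: n^2=-1\}$, and $\mathbb{C}=\mathrm{span}_{\mathbb{R}}\{1,i\}\subset\mathbb{H}$; complex scalars act on $\mathbb{H}$ and $\mathbb{H}^2$ by right multiplication, giving $\mathbb{H}=\mathbb{C}^2$, $\mathbb{H}^2=\mathbb{C}^4$. $M$ is a Riemann surface with universal cover $\tilde M$; for a 1-form, $*\omega(X)=\omega(JX)$, $J$ the complex structure of $TM$. CMC surface with $H=1$: a conformal immersion $f:M\to\mathbb{R}^3$ with Gauss map $N:M\to S^2$ ($*df=N\,df=-df\,N$) and constant mean curvature $1$, i.e. $df=-\frac12(dN-N*dN)$. Round spheres are excluded, so that $g=f+N$ is a branched conformal immersion; one has $df\wedge dg=dg\wedge df=0$. CMC family: for $\lambda\in\mathbb{C}\setminus\{0\}$ the flat connection $d^N_\lambda$ acts on $\alpha:\tilde M\to\mathbb{H}$ by $d^N_\lambda\alpha=d\alpha+\frac12 df\,(N\alpha(a_\lambda-1)+\alpha b_\lambda)$ with $a_\lambda=\frac{\lambda+\lambda^{-1}}2$, $b_\lambda=i\frac{\lambda^{-1}-\lambda}2$. Isothermic family: for $\varrho\in\mathbb{C}$ the flat connection $d_\varrho$ acts on maps $\tilde M\to\mathbb{H}^2$ by $d_\varrho\begin{pmatrix}\alpha\\ \beta\end{pmatrix}=\begin{pmatrix}d\alpha+df\,\beta\\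 d\beta+dg\,\alpha\varrho\end{pmatrix}$. A section is parallel if it is annihilated by the connection. *)

(* Defs.v *)
From HB Require Import structures.
From mathcomp Require Import all_boot all_order all_algebra.
From mathcomp Require Import complex ring.
From mathcomp Require Import all_classical all_reals all_analysis.
Set Warnings "-redundant-canonical-projection".

Import Order.TTheory GRing.Theory Num.Theory numFieldNormedType.Exports.

Set Implicit Arguments.
Unset Strict Implicit.
Unset Printing Implicit Defensive.

Local Open Scope classical_set_scope.
Local Open Scope ring_scope.

Section Quaternions.
Variable R : realType.

Definition quat : Type := 'rV[R]_4.

HB.instance Definition _ := NormedModule.copy quat 'rV[R]_4.

Definition mkQ (a b c d : R) : quat := \row_(i < 4) nth 0 [:: a; b; c; d] i.

Definition q0 (x : quat) : R := x 0 (inord 0).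
Definition q1 (x : quat) : R := x 0 (inord 1).
Definition q2 (x : quat) : R := x 0 (inord 2).
Definition q3 (x : quat) : R := x 0 (inord 3).

Definition mulQ (x y : quat) : quat :=
  mkQ (q0 x * q0 y - q1 x * q1 y - q2 x * q2 y - q3 x * q3 y)
      (q0 x * q1 y + q1 x * q0 y + q2 x * q3 y - q3 x * q2 y)
      (q0 x * q2 y - q1 x * q3 y + q2 x * q0 y + q3 x * q1 y)
      (q0 x * q3 y + q1 x * q2 y - q2 x * q1 y + q3 x * q0 y).

Lemma q0_mk a b c d : q0 (mkQ a b c d) = a.
Proof. by rewrite /q0 mxE inordK. Qed.
Lemma q1_mk a b c d : q1 (mkQ a b c d) = b.
Proof. by rewrite /q1 mxE inordK. Qed.
Lemma q2_mk a b c d : q2 (mkQ a b c d) = c.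
Proof. by rewrite /q2 mxE inordK. Qed.
Lemma q3_mk a b c d : q3 (mkQ a b c d) = d.
Proof. by rewrite /q3 mxE inordK. Qed.
Definition q_mk := (q0_mk, q1_mk, q2_mk, q3_mk).

Lemma q0D x y : q0 (x + y) = q0 x + q0 y. Proof. by rewrite /q0 mxE. Qed.
Lemma q1D x y : q1 (x + y) = q1 x + q1 y. Proof. by rewrite /q1 mxE. Qed.
Lemma q2D x y : q2 (x + y) = q2 x + q2 y. Proof. by rewrite /q2 mxE. Qed.
Lemma q3D x y : q3 (x + y) = q3 x + q3 y. Proof. by rewrite /q3 mxE. Qed.
Definition qD := (q0D, q1D, q2D, q3D).

Lemma q0Z k x : q0 (k *: x) = k * q0 x. Proof. by rewrite /q0 mxE. Qed.
Lemma q1Z k x : q1 (k *: x) = k * q1 x. Proof. by rewrite /q1 mxE. Qed.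
Lemma q2Z k x : q2 (k *: x) = k * q2 x. Proof. by rewrite /q2 mxE. Qed.
Lemma q3Z k x : q3 (k *: x) = k * q3 x. Proof. by rewrite /q3 mxE. Qed.
Definition qZ := (q0Z, q1Z, q2Z, q3Z).

Lemma quatP (x y : quat) :
  q0 x = q0 y -> q1 x = q1 y -> q2 x = q2 y -> q3 x = q3 y -> x = y.
Proof.
move=> h0 h1 h2 h3; apply/rowP => i.
have -> : i = inord i by apply: val_inj; rewrite /= inordK.
by case: i => -[|[|[|[|//]]]] ? /=.
Qed.

Let mulQA : associative mulQ.
Proof. by move=> x y z; apply: quatP; rewrite /mulQ !q_mk; ring. Qed.
Let mul1Q : left_id (mkQ 1 0 0 0) mulQ.
Proof. by move=> x; apply: quatP; rewrite /mulQ !q_mk; ring. Qed.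
Let mulQ1 : right_id (mkQ 1 0 0 0) mulQ.
Proof. by move=> x; apply: quatP; rewrite /mulQ !q_mk; ring. Qed.
Let mulQDl : left_distributive mulQ +%R.
Proof. by move=> x y z; apply: quatP; rewrite /mulQ !qD !q_mk; ring. Qed.
Let mulQDr : right_distributive mulQ +%R.
Proof. by move=> x y z; apply: quatP; rewrite /mulQ !qD !q_mk; ring. Qed.
Let oneQ_neq0 : mkQ 1 0 0 0 != 0.
Proof.
apply/eqP => /(congr1 q0) /eqP.
by rewrite q0_mk /q0 mxE oner_eq0.
Qed.

HB.instance Definition _ := GRing.Zmodule_isNzRing.Build quat
  mulQA mul1Q mulQ1 mulQDl mulQDr oneQ_neq0.

Lemma mulQE (x y : quat) : x * y = mulQ x y. Proof. by []. Qed.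

Let scaleQAl (k : R) (x y : quat) : k *: (x * y) = k *: x * y.
Proof.
by apply: quatP; rewrite !qZ !mulQE /mulQ !q_mk !qZ; ring.
Qed.

HB.instance Definition _ := GRing.Lmodule_isLalgebra.Build R quat scaleQAl.

Let scaleQAr (k : R) (x y : quat) : k *: (x * y) = x * (k *: y).
Proof.
by apply: quatP; rewrite !qZ !mulQE /mulQ !q_mk !qZ; ring.
Qed.

HB.instance Definition _ := GRing.Lalgebra_isAlgebra.Build R quat scaleQAr.

(* C = span {1, i} in H; complex scalars act on H by right multiplication. *)
Definition quat_of_C (z : R[i]) : quat := mkQ (complex.Re z) (complex.Im z) 0 0.

Definition ImH : set quat := [set x | q0 x = 0].
Definition S2 : set quat := [set n | ImH n /\ n * n = - 1].

(* The norm carried by [quat] as a row vector is the sup norm, so the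
   Euclidean structure of R^4 is given separately. *)
Definition dotQ (x y : quat) : R :=
  q0 x * q0 y + q1 x * q1 y + q2 x * q2 y + q3 x * q3 y.

End Quaternions.

Notation "z %:H" := (quat_of_C z) (at level 1, format "z %:H") : ring_scope.

Section PlaneCalculus.
Variable R : realType.

(* Class C^n on [U], through the values [z |-> 'd F z v] of the differential. *)
Fixpoint Ck_on (V W : normedModType R) (n : nat) (U : set V) (F : V -> W)
    : Prop :=
  if n is m.+1 then
    (forall z, U z -> differentiable F z) /\
    (forall v : V, Ck_on m U (fun z => 'd F z v))
  else forall z, U z -> {for z, continuous F}.

Definition smooth_on (V W : normedModType R) (U : set V) (F : V -> W) : Prop :=
  forall n, Ck_on n U F.

(* Multiplication by the imaginary unit on C = R^2. *)
Definition rotJ (z : R * R) : R * R := (- z.2, z.1).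

(* Holomorphic maps between open subsets of C = R^2: smooth maps with
   complex linear differential (Cauchy-Riemann). *)
Definition holomorphic_on (U : set (R * R)) (h : R * R -> R * R) : Prop :=
  smooth_on U h /\
  forall z, U z -> forall v, 'd h z (rotJ v) = rotJ ('d h z v).

End PlaneCalculus.

Section RiemannSurfaces.
Variable R : realType.

(* [param] is the inverse of the homeomorphism [coord : dom -> coord @` dom];
   the values of [coord] and [param] outside these sets are irrelevant. *)
Record chart (T : topologicalType) := Chart {
  dom : set T;
  coord : T -> R * R;
  param : R * R -> T;
  open_dom : open dom;
  open_cod : open (coord @` dom);
  coordK : forall x, dom x -> param (coord x) = x;
  coord_continuous : {within dom, continuous coord};
  param_continuous : {within coord @` dom, continuous param}
}.

Record riemannSurface := RiemannSurface {
  carrier :> topologicalType;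
  atlas : set (chart carrier);
  surface_hausdorff : hausdorff_space carrier;
  surface_connected : connected [set: carrier];
  atlas_cover : forall x, exists2 c, atlas c & dom c x;
  atlas_holomorphic : forall c1 c2, atlas c1 -> atlas c2 ->
    holomorphic_on (coord c1 @` (dom c1 `&` dom c2)) (coord c2 \o param c1)
}.

Definition holomorphic_map (M1 M2 : riemannSurface) (p : M1 -> M2) : Prop :=
  continuous p /\
  forall c1 c2, atlas c1 -> atlas c2 ->
    holomorphic_on (coord c1 @` (dom c1 `&` p @^-1` dom c2))
                   (coord c2 \o p \o param c1).

Definition unit_interval : set R := `[0, 1]%classic.

Definition path_connected (T : topologicalType) : Prop :=
  forall x y : T, exists g : R -> T,
    [/\ {within unit_interval, continuous g}, g 0 = x & g 1 = y].

Definition simply_connected (T : topologicalType) : Prop :=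
  path_connected T /\
  forall g : R -> T, {within unit_interval, continuous g} -> g 0 = g 1 ->
    exists h : R * R -> T,
      {within unit_interval `*` unit_interval, continuous h} /\
      forall s, unit_interval s ->
        [/\ h (0, s) = g s, h (1, s) = g 0, h (s, 0) = g 0 & h (s, 1) = g 0].

Definition homeomorphic_on (T1 T2 : topologicalType) (A : set T1) (B : set T2)
    (p : T1 -> T2) : Prop :=
  {within A, continuous p} /\ set_fun A B p /\
  exists s : T2 -> T1, {within B, continuous s} /\ set_fun B A s /\
    (forall x, A x -> s (p x) = x) /\ (forall y, B y -> p (s y) = y).

Definition covering_map (T1 T2 : topologicalType) (p : T1 -> T2) : Prop :=
  [/\ continuous p, range p = setT &
    forall y : T2, exists U : set T2, [/\ open U, U y &
      exists (I : Type) (V : I -> set T1),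
        [/\ forall i, open (V i), trivIset setT V, p @^-1` U = \bigcup_i V i &
            forall i, homeomorphic_on (V i) U p]]].

Definition universal_cover (Mt M : riemannSurface) (p : Mt -> M) : Prop :=
  [/\ covering_map p, holomorphic_map p & simply_connected Mt].

End RiemannSurfaces.

Section Forms.
Variables (R : realType) (M : riemannSurface R).

(* A [W]-valued 1-form, in local coordinates: [w c x v] is the value of the
   form at the point [x] of the chart domain of [c] on the tangent vector with
   coordinates [v] in [c]. *)
Definition form (W : Type) := chart R M -> M -> R * R -> W.

Definition eq_form (W : Type) (w1 w2 : form W) : Prop :=
  forall c, atlas c -> forall x, dom c x -> forall v, w1 c x v = w2 c x v.

Definition smooth_map (W : normedModType R) (F : M -> W) : Prop :=
  forall c, atlas c -> smooth_on (coord c @` dom c) (F \o param c).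

Definition dform (W : normedModType R) (F : M -> W) : form W :=
  fun c x v => 'd (F \o param c) (coord c x) v.

Definition zero_form (W : normedModType R) : form W := fun _ _ _ => 0.

(* ( *w )(X) = w (J X); the complex structure of TM is [rotJ] in each chart
   because the transition maps are holomorphic. *)
Definition star (W : Type) (w : form W) : form W :=
  fun c x v => w c x (rotJ v).

Definition conformal_immersion (f : M -> quat R) : Prop :=
  [/\ (forall x, ImH (f x)), smooth_map f &
    forall c, atlas c -> forall x, dom c x -> forall v, v != 0 ->
      let X := dform f c x v in let Y := star (dform f) c x v in
      [/\ X != 0, dotQ X X = dotQ Y Y & dotQ X Y = 0]].

Definition gauss_map (f N : M -> quat R) : Prop :=
  [/\ (forall x, S2 (N x)), smooth_map N,
      eq_form (star (dform f)) (fun c x v => N x * dform f c x v) &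
      eq_form (star (dform f)) (fun c x v => - (dform f c x v * N x))].

Definition mean_curvature_1 (f N : M -> quat R) : Prop :=
  eq_form (dform f)
    (fun c x v => - (2^-1 *: (dform N c x v - N x * star (dform N) c x v))).

Definition cmc1_surface (f N : M -> quat R) : Prop :=
  [/\ conformal_immersion f, gauss_map f N & mean_curvature_1 f N].

(* f is (part of) a round sphere; for H = 1 this is the case where f + N is
   constant. *)
Definition in_round_sphere (f : M -> quat R) : Prop :=
  exists (m : quat R) (r : R), [/\ ImH m, 0 < r &
    forall x, dotQ (f x - m) (f x - m) = r ^+ 2].

Definition cmc_a (l : R[i]) : R[i] := (l + l^-1) / 2.
Definition cmc_b (l : R[i]) : R[i] := 'i%C * ((l^-1 - l) / 2).

Definition cmc_connection (f N : M -> quat R) (l : R[i]) (alpha : M -> quat R)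
    : form (quat R) :=
  fun c x v => dform alpha c x v +
    2^-1 *: (dform f c x v * (N x * alpha x * (cmc_a l - 1)%:H
                              + alpha x * (cmc_b l)%:H)).

Definition isothermic_connection (f g : M -> quat R) (rho : R[i])
    (phi : M -> quat R * quat R) : form (quat R * quat R)%type :=
  let alpha := fun x => (phi x).1 in let beta := fun x => (phi x).2 in
  fun c x v => (dform alpha c x v + dform f c x v * beta x,
                dform beta c x v + dform g c x v * alpha x * rho%:H).

Definition cmc_parallel (f N : M -> quat R) (l : R[i]) (alpha : M -> quat R)
    : Prop :=
  smooth_map alpha /\ eq_form (cmc_connection f N l alpha) (@zero_form _).

Definition isothermic_parallel (f g : M -> quat R) (rho : R[i])
    (phi : M -> quat R * quat R) : Prop :=
  smooth_map phi /\ eq_form (isothermic_connection f g rho phi) (@zero_form _).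

End Forms.

(* Main.v *)
From HB Require Import structures.
From mathcomp Require Import all_boot all_order all_algebra.
From mathcomp Require Import complex ring.
From mathcomp Require Import all_classical all_reals all_analysis.
Require Import Defs.
Import Order.TTheory GRing.Theory Num.Theory numFieldNormedType.Exports.

(* For a solution (alpha, beta) of d_rho, the two relations
   alpha = alpha_+ + alpha_- and
   beta = (N alpha (a - 1) + (alpha_+ - alpha_-) b) / 2
   can be solved for alpha_+ and alpha_- because b <> 0:
   alpha_pm = (alpha +- (beta + N alpha rho) / s) / 2.  Since a^2 + b^2 = 1,
   the connection d^N at mu_pm has coefficients a and +- b, and
   N df = - df N together with dg = df + dN makes the dN terms of
   d alpha_pm cancel, which leaves d alpha_pm = - df beta_pm.  Replacing s
   by - s exchanges the two signs. *)

Set Implicit Arguments.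
Unset Strict Implicit.

Local Open Scope ring_scope.

(** * Calculus of maps of class C^n *)

Section SmoothCalculus.
Local Open Scope classical_set_scope.
Context {R : realType}.

(** The difference [G - F] vanishes near [z], so its differential at [z] is 0; adding it to [F]
    changes nothing. *)
Lemma is_diff_near_eq (V W : normedModType R) (F G dF : V -> W) (z : V) :
  is_diff z F dF -> (\forall x \near z, F x = G x) -> is_diff z G dF.
Proof.
move=> FdF FG.
pose D : V -> W := G - F.
have D0 : \forall x \near z, D x = 0.
  by apply: filterS FG => x; rewrite /D !fctE => ->; rewrite subrr.
have Dlin : D \o shift z = cst (D z) + (\0 : {linear V -> W}) +o_ (0 : V) id.
  apply/eqaddoP => e e0.
  have := D0; rewrite (near_shift 0) => D0'.
  have Dz : D z = 0 by exact: nbhs_singleton D0.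
  near=> x.
  have Dx : D (x + z) = 0.
    have : (D \o shift (z - 0)) x = 0 by near: x; exact: D0'.
    by rewrite /= subr0.
  rewrite !fctE /= Dz Dx /= addr0 subr0 normr0.
  by rewrite mulr_ge0// ltW.
have zero_cont : continuous (\0 : {linear V -> W}) by move=> x; exact: cvg_cst.
have Ddiff : is_diff z D 0.
  (* ['d] is a chosen linear map, so uniqueness must first identify it with 0 before the expansion
     [Dlin] yields differentiability. *)
  have dD : 'd D z = \0 :> (V -> W) := diff_unique zero_cont Dlin.
  apply: DiffDef; last by rewrite dD; apply/funext.
  by apply/diff_locallyP; rewrite dD.
have -> : G = F + D by rewrite /D addrC subrK.
by have := is_diffD FdF Ddiff; rewrite addr0.
Unshelve. all: by end_near. Qed.

Lemma Ck_onS (V W : normedModType R) (U : set V) (n : nat) (F : V -> W) :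
  Ck_on n.+1 U F -> Ck_on n U F.
Proof.
elim: n F => [|n IH] F [dF dFv].
  by move=> z Uz; apply: differentiable_continuous; exact: dF.
by split=> // v; exact/IH/dFv.
Qed.

(** Every clause of [Ck_on] is a condition at single points of the set. This allows smoothness of a
    pullback to be checked one chart overlap at a time. *)
Lemma Ck_on_local (V W : normedModType R) (U : set V) (n : nat) (F : V -> W) :
  (forall z, U z -> exists2 U', U' z & Ck_on n U' F) -> Ck_on n U F.
Proof.
elim: n F => [|n IH] F HF.
  by move=> z /HF[U' U'z]; apply.
split=> [z /HF[U' U'z [+ _]]|v]; first exact.
by apply: IH => z /HF[U' U'z [_ dFv]]; exists U' => //; exact: dFv.
Qed.

(** Openness turns agreement on [U] into agreement near each of its points, so the differentials
    agree on [U] as well and the induction goes on with them. *)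
Lemma Ck_on_eq (V W : normedModType R) (U : set V) (n : nat) (F G : V -> W) :
  open U -> (forall z, U z -> F z = G z) -> Ck_on n U F -> Ck_on n U G.
Proof.
move=> oU; elim: n F G => [|n IH] F G FG.
  move=> cF z Uz; have : F x @[x --> z] --> F z := cF z Uz.
  suff : G x @[x --> z] `=>` F x @[x --> z] by rewrite (FG z Uz); exact: cvg_trans.
  by apply: near_eq_cvg; near=> y; apply: FG; near: y; exact: open_nbhs_nbhs.
move=> [dF dFv].
have GdF z : U z -> is_diff z G ('d F z).
  move=> Uz; apply: (is_diff_near_eq (F := F)).
    exact/differentiableP/dF.
  by near=> y; apply: FG; near: y; exact: open_nbhs_nbhs.
split=> [z Uz|v]; first by have [] := GdF z Uz.
apply: IH (dFv v) => z Uz.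
have [_ E] := GdF z Uz; exact: (congr1 (fun d => d v) (esym E)).
Unshelve. all: by end_near. Qed.

Lemma Ck_on_cst (V W : normedModType R) (U : set V) (n : nat) (w : W) :
  Ck_on n U (cst w : V -> W).
Proof.
elim: n w => [|n IH] w; first by move=> z _; exact: cst_continuous.
split=> [z _|v]; first exact: differentiable_cst.
have -> : (fun z : V => 'd (cst w : V -> W) z v) = cst 0.
  by apply/funext => z; rewrite diff_cst.
exact: IH.
Qed.

Lemma Ck_on_linear (V W X : normedModType R) (U : set V) (n : nat)
    (L : {linear W -> X}) (F : V -> W) :
  open U -> continuous L -> Ck_on n U F -> Ck_on n U (L \o F).
Proof.
move=> oU cL; elim: n F => [|n IH] F.
  by move=> cF z Uz; apply: continuous_comp; [exact: cF|exact: cL].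
move=> [dF dFv]; split=> [z Uz|v].
  by apply: differentiable_comp; [exact: dF|exact: linear_differentiable].
apply: Ck_on_eq oU _ (IH _ (dFv v)) => z Uz.
rewrite diff_comp /=; [|exact: dF|exact: linear_differentiable].
by rewrite (diff_lin _ cL).
Qed.

Lemma Ck_onD (V W : normedModType R) (U : set V) (n : nat) (F G : V -> W) :
  open U -> Ck_on n U F -> Ck_on n U G -> Ck_on n U (F + G).
Proof.
move=> oU; elim: n F G => [|n IH] F G.
  by move=> cF cG z Uz; apply: continuousD; [exact: cF|exact: cG].
move=> [dF dFv] [dG dGv]; split=> [z Uz|v].
  by apply: differentiableD; [exact: dF|exact: dG].
apply: Ck_on_eq oU _ (IH _ _ (dFv v) (dGv v)) => z Uz.
by rewrite diffD; [|exact: dF|exact: dG].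
Qed.

Lemma is_diff_bilin (V W1 W2 X : normedModType R) (B : W1 -> W2 -> X)
    (F : V -> W1) (G : V -> W2) (z : V) :
  bilinear_for *:%R *:%R B -> continuous (fun p => B p.1 p.2) ->
  differentiable F z -> differentiable G z ->
  is_diff z (fun x => B (F x) (G x))
    (fun v => B (F z) ('d G z v) + B ('d F z v) (G z)).
Proof.
move=> linB cB dF dG.
pose BL : {bilinear W1 -> W2 -> X} :=
  HB.pack B (bilinear_isBilinear.Build R W1 W2 X *:%R *:%R B linB).
pose P x := (F x, G x).
have dP : differentiable P z by exact: differentiable_pair.
have dB : differentiable (fun p => B p.1 p.2) (P z) :=
  differentiable_bilin (f := BL) (P z) cB.
apply: DiffDef; first exact: differentiable_comp dP dB.
rewrite (diff_comp dP dB) (diff_bilin (f := BL))//.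
by apply/funext => v /=; rewrite diff_pair.
Qed.

(** By the product rule the derivative in direction [v] is a sum of two terms of the same shape,
    each with one factor differentiated; the other factor is lowered by one order with [Ck_onS]. *)
Lemma Ck_on_bilin (V W1 W2 X : normedModType R) (U : set V) (n : nat)
    (B : W1 -> W2 -> X) (F : V -> W1) (G : V -> W2) :
  bilinear_for *:%R *:%R B -> continuous (fun p => B p.1 p.2) -> open U ->
  Ck_on n U F -> Ck_on n U G -> Ck_on n U (fun z => B (F z) (G z)).
Proof.
move=> linB cB oU; elim: n F G => [|n IH] F G.
  move=> cF cG z Uz.
  apply: (@continuous_comp _ _ _ (fun x => (F x, G x)) (fun p => B p.1 p.2)).
    by apply: cvg_pair; [exact: cF|exact: cG].
  exact: cB.
move=> CF CG; have [[dF dFv] [dG dGv]] := (CF, CG).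
have dB z : U z -> is_diff z (fun x => B (F x) (G x))
    (fun v => B (F z) ('d G z v) + B ('d F z v) (G z)).
  by move=> Uz; apply: is_diff_bilin => //; [exact: dF|exact: dG].
split=> [z /dB[]//|v].
have CB := Ck_onD oU (IH _ _ (Ck_onS CF) (dGv v))
  (IH _ _ (dFv v) (Ck_onS CG)).
by apply: Ck_on_eq oU _ CB => z /dB[_ ->].
Qed.

Lemma scale_bilinear (W : lmodType R) :
  bilinear_for *:%R *:%R (fun (k : R^o) (w : W) => k *: w).
Proof.
split=> [w k x y|x k w1 w2] /=; first by rewrite scalerDl scalerA.
by rewrite scalerDr !scalerA mulrC.
Qed.

Lemma Ck_on_comp (V W : normedModType R) (U : set V) (U' : set (R * R))
    (n : nat) (h : V -> R * R) (F : R * R -> W) :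
  open U -> (forall z, U z -> U' (h z)) ->
  Ck_on n U h -> Ck_on n U' F -> Ck_on n U (F \o h).
Proof.
move=> oU hU; elim: n F => [|n IH] F.
  by move=> ch cF z Uz; apply: continuous_comp; [exact: ch|exact/cF/hU].
move=> Ch [dF dFv]; have [dh dhv] := Ch.
split=> [z Uz|v].
  by apply: differentiable_comp; [exact: dh|exact/dF/hU].
(* The induction hypothesis controls the differential of [F] only in fixed
   directions, so it is expanded along the two coordinate directions. *)
have partial (l : R * R -> R^o) (e : R * R) : linear l -> continuous l ->
    Ck_on n U (fun z => l ('d h z v) *: 'd F (h z) e).
  move=> linl cl.
  pose L : {linear (R * R)%type -> R^o} :=
    HB.pack l (GRing.isLinear.Build _ _ _ _ l linl).
  apply: (Ck_on_bilin (scale_bilinear W)) => //.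
  - exact: scale_continuous.
  - by apply: (Ck_on_linear (L := L)) => //; exact: dhv.
  - by apply: IH (Ck_onS Ch) (dFv e).
have Cfst : continuous (fst : R * R -> R^o) by move=> x; exact: cvg_fst.
have Csnd : continuous (snd : R * R -> R^o) by move=> x; exact: cvg_snd.
have lfst : linear (fst : R * R -> R^o) by [].
have lsnd : linear (snd : R * R -> R^o) by [].
have C := Ck_onD oU (partial _ (1, 0) lfst Cfst)
  (partial _ (0, 1) lsnd Csnd).
apply: Ck_on_eq oU _ C => z Uz.
rewrite diff_comp /=; [|exact: dh|exact/dF/hU].
rewrite !fctE -!linearZ -linearD; congr ('d F (h z) _).
case: ('d h z v) => x y.
change ((x * 1 + y * 0, x * 0 + y * 1) = (x, y) :> R * R).
by rewrite !mulr1 !mulr0 addr0 add0r.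
Qed.

End SmoothCalculus.

(** * Quaternion multiplication and the embedding of the complex numbers *)

Section QuaternionFacts.
Local Open Scope classical_set_scope.
Context {R : realType}.

Lemma quat_mul_continuous : continuous (fun p : quat R * quat R => p.1 * p.2).
Proof.
have q_cont (i : 'I_4) (T : topologicalType) (h : T -> quat R) :
    continuous h -> continuous (fun t => h t 0 i : R).
  move=> ch t; apply: (@continuous_comp _ _ _ h (fun x : 'M[R]_(1, 4) => x 0 i)).
    exact: ch.
  exact: matrix_normedtype.coord_continuous.
have mk_cont (T : topologicalType) (a b c d : T -> R) :
    continuous a -> continuous b -> continuous c -> continuous d ->
    continuous (fun t => mkQ (a t) (b t) (c t) (d t)).
  move=> ca cb cc cd.
  have -> : (fun t => mkQ (a t) (b t) (c t) (d t)) =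
      (fun t => a t *: mkQ 1 0 0 0 + b t *: mkQ 0 1 0 0
                + c t *: mkQ 0 0 1 0 + d t *: mkQ 0 0 0 1).
    by apply/funext => t; apply: quatP; rewrite !qD !qZ !q_mk; ring.
  have cZ (k : T -> R) (w : quat R) : continuous k ->
      continuous (fun t => k t *: w).
    by move=> ck t; apply: cvgZr_tmp; exact: ck.
  move=> t; apply: cvgD; last exact: (cZ _ _ cd).
  apply: cvgD; last exact: (cZ _ _ cc).
  by apply: cvgD; [exact: (cZ _ _ ca)|exact: (cZ _ _ cb)].
have c1 : continuous (fst : quat R * quat R -> quat R).
  by move=> x; exact: cvg_fst.
have c2 : continuous (snd : quat R * quat R -> quat R).
  by move=> x; exact: cvg_snd.
have cM i j : continuous (fun p : quat R * quat R => p.1 0 i * p.2 0 j : R).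
  by move=> p; apply: continuousM; [exact: (q_cont i _ _ c1)|exact: (q_cont j _ _ c2)].
apply: mk_cont => p.
(* The four goals are the components of the product; [cvgD] and [cvgB] follow the signs of their
   terms from last to first. *)
- by do 3![apply: cvgB; last exact: (cM _ _ p)]; exact: (cM _ _ p).
- apply: cvgB; last exact: (cM _ _ p).
  by do 2![apply: cvgD; last exact: (cM _ _ p)]; exact: (cM _ _ p).
- apply: cvgD; last exact: (cM _ _ p).
  apply: cvgD; last exact: (cM _ _ p).
  by apply: cvgB; exact: (cM _ _ p).
- apply: cvgD; last exact: (cM _ _ p).
  apply: cvgB; last exact: (cM _ _ p).
  by apply: cvgD; exact: (cM _ _ p).
Qed.

Lemma quat_mul_bilinear :
  bilinear_for *:%R *:%R (fun x y : quat R => x * y).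
Proof.
split=> [w k x y|x k w1 w2] /=; first by rewrite mulrDl scalerAl.
by rewrite mulrDr scalerAr.
Qed.

(** With the next two lemmas, this lets identities between complex scalars be settled in the
    commutative field [R[i]]. *)
Lemma quat_of_CD (z w : R[i]) : (z + w)%:H = z%:H + w%:H.
Proof.
by case: z w => a b [c d]; apply: quatP; rewrite !qD !q_mk /=; ring.
Qed.

Lemma quat_of_CM (z w : R[i]) : (z * w)%:H = z%:H * w%:H.
Proof.
by case: z w => a b [c d]; apply: quatP; rewrite mulQE /mulQ !q_mk /=; ring.
Qed.

Lemma quat_of_CN (z : R[i]) : (- z)%:H = - z%:H.
Proof.
case: z => a b; rewrite -[RHS]scaleN1r.
by apply: quatP; rewrite !qZ !q_mk /=; ring.
Qed.

Lemma qN :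
  ((forall x : quat R, q0 (- x) = - q0 x) * (forall x : quat R, q1 (- x) = - q1 x))
  * ((forall x : quat R, q2 (- x) = - q2 x) * (forall x : quat R, q3 (- x) = - q3 x)).
Proof. by split; split=> x; rewrite -[- x]scaleN1r qZ mulN1r. Qed.

End QuaternionFacts.

(** * Differentials of maps on a Riemann surface *)

Section FormCalculus.
Local Open Scope classical_set_scope.
Context {R : realType} {M : riemannSurface R}.

Lemma smooth_map_differentiable (W : normedModType R) (F : M -> W) c x :
  smooth_map F -> atlas c -> dom c x -> differentiable (F \o param c) (coord c x).
Proof.
by move=> sF ac cx; have [dF _] := sF c ac 1%N; apply: dF; exists x.
Qed.

Lemma smooth_mapD (W : normedModType R) (F G : M -> W) :
  smooth_map F -> smooth_map G -> smooth_map (fun x => F x + G x).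
Proof.
move=> sF sG c ac n.
exact: (Ck_onD (@open_cod _ _ c) (sF c ac n) (sG c ac n)).
Qed.

Lemma smooth_map_linear (W X : normedModType R) (L : {linear W -> X})
    (F : M -> W) :
  continuous L -> smooth_map F -> smooth_map (fun x => L (F x)).
Proof.
move=> cL sF c ac n.
exact: (Ck_on_linear (@open_cod _ _ c) cL (sF c ac n)).
Qed.

Lemma smooth_mapZ (W : normedModType R) (k : R) (F : M -> W) :
  smooth_map F -> smooth_map (fun x => k *: F x).
Proof.
apply: (smooth_map_linear (L := *:%R k)) => x.
exact: differentiable_continuous.
Qed.

Lemma smooth_mapM (F G : M -> quat R) :
  smooth_map F -> smooth_map G -> smooth_map (fun x => F x * G x).
Proof.
move=> sF sG c ac n.
exact: (Ck_on_bilin quat_mul_bilinear quat_mul_continuous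
  (@open_cod _ _ c) (sF c ac n) (sG c ac n)).
Qed.

Lemma smooth_map_cst (W : normedModType R) (w : W) :
  smooth_map (fun _ : M => w).
Proof. by move=> c ac n; exact: Ck_on_cst. Qed.

Lemma dformD (W : normedModType R) (F G : M -> W) c x v :
  smooth_map F -> smooth_map G -> atlas c -> dom c x ->
  dform (fun y => F y + G y) c x v = dform F c x v + dform G c x v.
Proof.
move=> sF sG ac cx; have dF := smooth_map_differentiable sF ac cx.
have dG := smooth_map_differentiable sG ac cx.
exact: (congr1 (fun h => h v) (diffD dF dG)).
Qed.

Lemma dform_linear (W X : normedModType R) (L : {linear W -> X})
    (F : M -> W) c x v :
  continuous L -> smooth_map F -> atlas c -> dom c x ->
  dform (fun y => L (F y)) c x v = L (dform F c x v).
Proof.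
move=> cL sF ac cx; have dF := smooth_map_differentiable sF ac cx.
have dL : differentiable L ((F \o param c) (coord c x)).
  exact: linear_differentiable.
have := congr1 (fun h => h v) (diff_comp dF dL).
by rewrite /= (diff_lin _ cL).
Qed.

Lemma dformZ (W : normedModType R) (k : R) (F : M -> W) c x v :
  smooth_map F -> atlas c -> dom c x ->
  dform (fun y => k *: F y) c x v = k *: dform F c x v.
Proof.
apply: (dform_linear (L := *:%R k)) => y.
exact: differentiable_continuous.
Qed.

Lemma dformM (F G : M -> quat R) c x v :
  smooth_map F -> smooth_map G -> atlas c -> dom c x ->
  dform (fun y => F y * G y) c x v =
    F x * dform G c x v + dform F c x v * G x.
Proof.
move=> sF sG ac cx; have dF := smooth_map_differentiable sF ac cx.
have dG := smooth_map_differentiable sG ac cx.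
have [_ dM] := is_diff_bilin quat_mul_bilinear
  quat_mul_continuous dF dG.
have := congr1 (fun h => h v) dM.
by rewrite /= (coordK cx).
Qed.

Lemma dform_cst (W : normedModType R) (w : W) c x v :
  dform (fun _ : M => w) c x v = 0.
Proof. exact: (congr1 (fun h => h v) (diff_cst w (coord c x))). Qed.

(** Complex scalars act from the right; for [q] coming from [R[i]] this is the complex linearity of
    the differential. *)
Lemma dformMr (F : M -> quat R) (q : quat R) c x v :
  smooth_map F -> atlas c -> dom c x ->
  dform (fun y => F y * q) c x v = dform F c x v * q.
Proof.
move=> sF ac cx; rewrite (dformM (G := fun=> q))//; last exact: smooth_map_cst.
by rewrite dform_cst mulr0 add0r.
Qed.

End FormCalculus.

(** * Pullback along a holomorphic map *)

Section Pullback.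
Local Open Scope classical_set_scope.
Context {R : realType} {M1 M2 : riemannSurface R} (p : M1 -> M2).
Hypothesis hol_p : holomorphic_map p.

Let transition (c1 : chart R M1) (c2 : chart R M2) : R * R -> R * R :=
  coord c2 \o p \o param c1.

Let overlap (c1 : chart R M1) (c2 : chart R M2) : set (R * R) :=
  coord c1 @` (dom c1 `&` p @^-1` dom c2).

Let overlap_open c1 c2 : open (overlap c1 c2).
Proof.
have [cp _] := hol_p.
have oW : open (p @^-1` dom c2).
  by move/continuousP: cp; apply; exact: open_dom.
have cparam : {in coord c1 @` dom c1, continuous (param c1)}.
  by rewrite -continuous_open_subspace;
    [exact: param_continuous|exact: open_cod].
(* The overlap is the preimage of an open set under [param c1], which is continuous on an open
   set. *)
have -> : overlap c1 c2 =
    coord c1 @` dom c1 `&` param c1 @^-1` (p @^-1` dom c2).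
  apply/seteqP; split=> [_ [x [cx px] <-]|_ [[x cx <-]] /=].
    by split; [exists x|rewrite /= (coordK cx)].
  by rewrite (coordK cx) => px; exists x.
by move/(continuous_inP _ (@open_cod _ _ c1)): cparam; apply.
Qed.

Let comp_transition (W : Type) (F : M2 -> W) c1 c2 z : overlap c1 c2 z ->
  ((F \o param c2) \o transition c1 c2) z = ((F \o p) \o param c1) z.
Proof.
by move=> [x [cx px] <-]; rewrite /transition /= (coordK cx) (coordK px).
Qed.

Let transition_cod c1 c2 z : overlap c1 c2 z ->
  (coord c2 @` dom c2) (transition c1 c2 z).
Proof.
move=> [x [cx px] <-]; exists (p x) => //.
by rewrite /transition /= (coordK cx).
Qed.

(** On each overlap the pullback is [F] read in a chart of [M2], composed with the coordinate
    expression of [p], which is smooth. *)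
Lemma smooth_map_pullback (W : normedModType R) (F : M2 -> W) :
  smooth_map F -> smooth_map (F \o p).
Proof.
move=> sF c1 a1 n; apply: Ck_on_local => _ [x cx <-].
have [c2 a2 c2px] := atlas_cover (p x).
exists (overlap c1 c2); first by exists x.
have [_ /(_ c1 c2 a1 a2)[str _]] := hol_p.
apply: (Ck_on_eq (F := (F \o param c2) \o transition c1 c2)
  (@overlap_open c1 c2)); first exact: comp_transition.
apply: (Ck_on_comp (@overlap_open c1 c2) (@transition_cod c1 c2) (str n)).
exact: sF.
Qed.

(** This is the chain rule in charts. It carries pointwise identities between differentials from the
    surface to its cover. *)
Lemma dform_pullback c1 c2 x v (W : normedModType R) (F : M2 -> W) :
  atlas c1 -> dom c1 x -> atlas c2 -> dom c2 (p x) -> smooth_map F ->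
  dform (F \o p) c1 x v =
    dform F c2 (p x) ('d (coord c2 \o p \o param c1) (coord c1 x) v).
Proof.
move=> a1 cx a2 cpx sF.
have Oz : overlap c1 c2 (coord c1 x) by exists x.
have trz : transition c1 c2 (coord c1 x) = coord c2 (p x).
  by rewrite /transition /= (coordK cx).
have [_ /(_ c1 c2 a1 a2)[str _]] := hol_p.
have dtr : differentiable (transition c1 c2) (coord c1 x).
  by have [dtr _] := str 1%N; exact: dtr.
have dF : differentiable (F \o param c2) (transition c1 c2 (coord c1 x)).
  by rewrite trz; exact: smooth_map_differentiable.
have dcomp : is_diff (coord c1 x) ((F \o param c2) \o transition c1 c2)
    ('d (F \o param c2) (coord c2 (p x)) \o 'd (transition c1 c2) (coord c1 x)).
  apply: DiffDef; first exact: (differentiable_comp dtr dF).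
  by rewrite -trz; exact: (diff_comp dtr dF).
have [_ E] := is_diff_near_eq dcomp
  (filterS (@comp_transition _ F c1 c2)
    (open_nbhs_nbhs (conj (@overlap_open c1 c2) Oz))).
exact: (congr1 (fun h => h v) E).
Qed.

End Pullback.

(** * The spectral parameters of the CMC family *)

Lemma cmc_parameter_inv (R : rcfType) (rho s : R[i]) :
  s ^+ 2 = rho * (1 - rho) ->
  ((1 - 2 * rho) + 'i%C * (2 * s))^-1 = (1 - 2 * rho) - 'i%C * (2 * s).
Proof.
move=> hs; set z := (X in X^-1 = _); set z' := RHS.
have i2 : 'i%C ^+ 2 = -1 :> R[i] by exact: sqr_i.
have zz' : z * z' = 1.
  (* The product is a^2 + b^2 with a = 1 - 2 rho and b = 2 s, and this equals 1 by [hs]. *)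
  have -> : z * z' = (1 - 2 * rho) ^+ 2 - 'i%C ^+ 2 * (4 * s ^+ 2).
    by rewrite /z /z'; ring.
  by rewrite i2 hs; ring.
have z0 : z != 0 by apply: contra_eq_neq zz' => ->; rewrite mul0r eq_sym oner_eq0.
by apply: (mulfI z0); rewrite zz' divff.
Qed.

Lemma cmc_aE (R : realType) (rho s : R[i]) :
  s ^+ 2 = rho * (1 - rho) ->
  cmc_a (1 - 2 * rho + 'i%C * (2 * s)) = 1 - 2 * rho.
Proof. by move=> hs; rewrite /cmc_a (cmc_parameter_inv hs); field. Qed.

Lemma cmc_bE (R : realType) (rho s : R[i]) :
  s ^+ 2 = rho * (1 - rho) ->
  cmc_b (1 - 2 * rho + 'i%C * (2 * s)) = 2 * s.
Proof.
move=> hs; rewrite /cmc_b (cmc_parameter_inv hs).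
have i2 : 'i%C ^+ 2 = -1 :> R[i] by exact: sqr_i.
have -> : 1 - 2 * rho - 'i%C * (2 * s) - (1 - 2 * rho + 'i%C * (2 * s)) =
  'i%C * s * (- 2 * 2) by ring.
by rewrite !mulrA -expr2 i2; field.
Qed.

(** * Splitting a parallel section of the isothermic family *)

Section Splitting.
Context {R : realType} {X : riemannSurface R}.

(** One formula serves both summands: the root [s] gives alpha_+, and [- s] gives alpha_-. *)
Definition cmc_part (N : X -> quat R) (rho s : R[i])
    (phi : X -> quat R * quat R) (x : X) : quat R :=
  2^-1 *: ((phi x).1 + ((phi x).2 + N x * (phi x).1 * rho%:H) * (s^-1)%:H).

(** Pointwise form of the parallel equation: [Df], [A], [B], [n] stand for df, alpha, beta, N. The
    first summand is the differential of [C] once the dN terms are gone, the second the connection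
    term. *)
Lemma quat_splitting_identity (Df A B n : quat R) (rho s : R[i]) :
  s != 0 -> s ^+ 2 = rho * (1 - rho) -> n * n = -1 -> n * Df = - (Df * n) ->
  let C := 2^-1 *: (A + (B + n * A * rho%:H) * (s^-1)%:H) in
  2^-1 *: (- (Df * B) + (- (Df * A * rho%:H) - n * (Df * B) * rho%:H) * (s^-1)%:H)
   + 2^-1 *: (Df * (n * C * (1 - 2 * rho - 1)%:H + C * (2 * s)%:H)) = 0.
Proof.
move=> s0 hs nn nDf C.
pose r := rho%:H; pose S := s%:H; pose T := s^-1%:H; pose K := (rho / s)%:H.
have rT : r * T = K by rewrite -quat_of_CM.
have Tr : T * r = K by rewrite -quat_of_CM mulrC.
have TS : T * S = 1 by rewrite -quat_of_CM mulVf.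
have KS : K * S = r by rewrite -quat_of_CM divfK.
(* After multiplication by [s] this reads s^2 + rho^2 = rho, which is [hs]. *)
have KrS : S + K * r = K.
  rewrite -quat_of_CM -quat_of_CD; congr quat_of_C.
  apply: (mulIf s0); rewrite mulrDl -expr2 hs mulrAC !divfK//; ring.
have CE : C = 2^-1 *: (A + B * T + n * A * K).
  by rewrite /C mulrDl -[n * A * _ * _]mulrA rT addrA.
have r2 : (1 - 2 * rho - 1)%:H = - (r + r).
  by rewrite -quat_of_CD -quat_of_CN; congr quat_of_C; ring.
have S2 : (2 * s)%:H = S + S by rewrite -quat_of_CD; congr quat_of_C; ring.
(* The left side is twice the beta belonging to the summand [C]. *)
have W : n * C * (1 - 2 * rho - 1)%:H + C * (2 * s)%:H =
    B + A * K - n * B * K.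
  transitivity ((A + B * T + n * A * K) * S - n * (A + B * T + n * A * K) * r).
    rewrite r2 S2 CE -scalerAr -!scalerAl mulrN !mulrDr.
    (* Products become atoms, so that passing to coordinates leaves linear identities over [R]. *)
    set x := (_ * r); set y := (_ * S).
    by apply: quatP; rewrite !(qD, qN, qZ); field.
  rewrite !mulrDl !mulrDr !mulrDl -!mulrA TS KS Tr mulr1 [n * (n * _)]mulrA nn.
  rewrite mulN1r (_ : A * K = A * S + A * (K * r)); last by rewrite -mulrDr KrS.
  set x1 := A * S; set x2 := n * (A * r); set x3 := n * (B * K).
  set x4 := A * (K * r).
  by apply: quatP; rewrite !(qD, qN, qZ); ring.
rewrite W -scalerDr; apply/eqP; rewrite scaler_eq0; apply/orP; right; apply/eqP.
(* Anticommutation moves [n] to the right of [Df], after which all terms cancel in pairs. *)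
rewrite [n * (Df * B)]mulrA nDf !mulrBr !mulrDr !mulrDl !mulNr -!mulrA rT.
set x1 := Df * B; set x2 := Df * (A * K); set x3 := Df * (n * (B * K)).
by rewrite [- x1 + _]addrA -!opprD addNr.
Qed.

Lemma cmc_part_parallel (f N : X -> quat R) (rho s : R[i])
    (phi : X -> quat R * quat R) :
  smooth_map f -> smooth_map N -> (forall x, N x * N x = -1) ->
  eq_form (fun c x v => N x * dform f c x v)
          (fun c x v => - (dform f c x v * N x)) ->
  s != 0 -> s ^+ 2 = rho * (1 - rho) ->
  isothermic_parallel f (fun x => f x + N x) rho phi ->
  cmc_parallel f N (1 - 2 * rho + 'i%C * (2 * s)) (cmc_part N rho s phi).
Proof.
move=> sf sN NN Ndf s0 hs [sphi par].
have sA : smooth_map (fun x => (phi x).1).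
  by apply: (smooth_map_linear (L := fst)) => // x; exact: cvg_fst.
have sB : smooth_map (fun x => (phi x).2).
  by apply: (smooth_map_linear (L := snd)) => // x; exact: cvg_snd.
have sNA : smooth_map (fun x => N x * (phi x).1) by exact: smooth_mapM.
have sr (F : X -> quat R) q : smooth_map F -> smooth_map (fun x => F x * q).
  by move=> sF; apply: (smooth_mapM (G := fun=> q)) => //; exact: smooth_map_cst.
have sNAr := sr _ rho%:H sNA.
have sBN := smooth_mapD sB sNAr.
have sBNT := sr _ (s^-1)%:H sBN.
have sC := smooth_mapD sA sBNT.
split; first exact: smooth_mapZ.
move=> c ac x cx v; rewrite /cmc_connection cmc_aE// cmc_bE//.
have [dA dB] : dform (fun x => (phi x).1) c x v = - (dform f c x v * (phi x).2) /\
    dform (fun x => (phi x).2) c x v =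
      - ((dform f c x v + dform N c x v) * (phi x).1 * rho%:H).
  have [/eqP E1 /eqP E2] := par c ac x cx v.
  rewrite -(dformD _ sf sN)//.
  by split; apply/eqP; rewrite -addr_eq0.
(* Zero is replaced by the left side of the algebraic identity. Its second summand is already the
   connection term, so only the differential remains to be matched. *)
rewrite /zero_form -[RHS](quat_splitting_identity (phi x).1 (phi x).2 s0 hs (NN x)
  (Ndf c ac x cx v)).
congr (_ + _).
rewrite dformZ// dformD// dformMr// dformD// dformMr//.
rewrite dformM// dA dB.
(* [D] stands for dN: it occurs once in d beta, through dg, and once with the opposite sign in the
   differential of N alpha. *)
have cancel_dN (n F D A B r : quat R) :
    - ((F + D) * A * r) + (n * - (F * B) + D * A) * r =
    - (F * A * r) - n * (F * B) * r.
  by rewrite !mulrDl mulrN mulNr opprD addrACA addNr addr0.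
apply: (congr1 (fun w => _ *: w)); apply: (congr1 (fun w => _ + w)).
exact: (congr1 (fun w => w * _) (cancel_dN _ _ _ _ _ _)).
Qed.

(** The term odd in [s] cancels and the even one doubles. *)
Lemma cmc_part_sum (N : X -> quat R) rho s phi x :
  cmc_part N rho s phi x + cmc_part N rho (- s) phi x = (phi x).1.
Proof.
rewrite /cmc_part invrN quat_of_CN mulrN -scalerDr addrACA subrr addr0.
by apply: quatP; rewrite !(qD, qZ); field.
Qed.

Lemma cmc_part_diff (N : X -> quat R) rho s phi x : s != 0 ->
  (cmc_part N rho s phi x - cmc_part N rho (- s) phi x) * s%:H =
  (phi x).2 + N x * (phi x).1 * rho%:H.
Proof.
move=> s0; rewrite /cmc_part invrN quat_of_CN mulrN -scalerBr.
set q := (_ + _ * rho%:H).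
have -> : (phi x).1 + q * (s^-1)%:H - ((phi x).1 - q * (s^-1)%:H) =
    2%:R *: (q * (s^-1)%:H).
  by rewrite opprD opprK addrACA subrr add0r scaler_nat.
rewrite scalerA mulVf ?pnatr_eq0// scale1r -mulrA -quat_of_CM mulVf//.
exact: mulr1.
Qed.

(** This recovers beta from the two summands: [- (r + r)] is a - 1 and [S + S] is b, so the half sum
    is (alpha_+ - alpha_-) s - N alpha rho. *)
Lemma half_sum_split (n A B Ap Am r S : quat R) :
  Ap + Am = A -> (Ap - Am) * S = B + n * A * r ->
  2^-1 *: (n * Ap * - (r + r) + Ap * (S + S))
    + 2^-1 *: (n * Am * - (r + r) - Am * (S + S)) = B.
Proof.
move=> <- BE.
have -> : B = (Ap - Am) * S - n * (Ap + Am) * r by rewrite BE addrK.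
rewrite mulrBl !(mulrDr, mulrDl, mulrN).
by apply: quatP; rewrite !(qD, qN, qZ); field.
Qed.

End Splitting.

(** * The decomposition on the universal cover *)

Unset Implicit Arguments.
Set Strict Implicit.

Theorem theorem4p2 (R : realType) (M Mt : riemannSurface R) (p : Mt -> M)
  (hp : universal_cover p)
  (f N : M -> quat R)
  (hf : cmc1_surface f N)
  (hround : ~ in_round_sphere f)
  (g : M -> quat R) (hg : forall x, g x = f x + N x)
  (rho : R[i]) (hrho0 : rho != 0) (hrho1 : rho != 1)
  (s : R[i]) (hs : s ^+ 2 = rho * (1 - rho))
  (a b mu_p mu_m : R[i])
  (ha : a = 1 - 2 * rho) (hb : b = 2 * s)
  (hmu_p : mu_p = a + 'i%C * b) (hmu_m : mu_m = a - 'i%C * b)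
  (phi : Mt -> quat R * quat R)
  (hphi : isothermic_parallel (f \o p) (g \o p) rho phi) :
  exists alpha_p alpha_m beta_p beta_m : Mt -> quat R,
    [/\ (forall x, phi x = (alpha_p x, beta_p x) + (alpha_m x, beta_m x)),
        cmc_parallel (f \o p) (N \o p) mu_p alpha_p,
        cmc_parallel (f \o p) (N \o p) mu_m alpha_m,
        (forall x, beta_p x =
           2^-1 *: (N (p x) * alpha_p x * (a - 1)%:H + alpha_p x * b%:H)) &
        (forall x, beta_m x =
           2^-1 *: (N (p x) * alpha_m x * (a - 1)%:H - alpha_m x * b%:H))].
Proof.
have [_ hol_p _] := hp.
have [[_ sf _] [NS2 sN starL starR] _] := hf.
have Ndf : eq_form (fun c x v => N x * dform f c x v)
    (fun c x v => - (dform f c x v * N x)).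
  by move=> c ac x cx v; rewrite -(starL c ac x cx v); exact: starR.
(* Both exclusions, rho = 0 and rho = 1, enter here. *)
have s0 : s != 0.
  by rewrite -sqrf_eq0 hs mulf_neq0// subr_eq0 eq_sym.
have gE : g \o p = (fun x => (f \o p) x + (N \o p) x).
  by apply/funext => x /=; rewrite hg.
rewrite gE in hphi.
have NdFp : eq_form (fun c x v => (N \o p) x * dform (f \o p) c x v)
    (fun c x v => - (dform (f \o p) c x v * (N \o p) x)).
  move=> c ac x cx v; have [c2 a2 cpx] := atlas_cover (p x).
  by rewrite (dform_pullback hol_p v ac cx a2 cpx sf); exact: Ndf.
have par t : t != 0 -> t ^+ 2 = rho * (1 - rho) ->
    cmc_parallel (f \o p) (N \o p) (1 - 2 * rho + 'i%C * (2 * t))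
      (cmc_part (N \o p) rho t phi).
  move=> t0 ht; apply: cmc_part_parallel => //.
  - exact: smooth_map_pullback.
  - exact: smooth_map_pullback.
  - by move=> x /=; have [] := NS2 (p x).
pose alpha t := cmc_part (N \o p) rho t phi.
exists (alpha s), (alpha (- s)).
(* The betas are defined by the required formulas; what has to be proved is that they add up to the
   second component of [phi]. *)
exists (fun x => 2^-1 *: (N (p x) * alpha s x * (a - 1)%:H + alpha s x * b%:H)).
exists (fun x => 2^-1 *: (N (p x) * alpha (- s) x * (a - 1)%:H
                          - alpha (- s) x * b%:H)).
split=> //.
- move=> x; rewrite [LHS]surjective_pairing; congr (_, _).
    by rewrite cmc_part_sum.
  have -> : b%:H = s%:H + s%:H.
    by rewrite hb -quat_of_CD; congr quat_of_C; ring.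
  have -> : (a - 1)%:H = - (rho%:H + rho%:H).
    by rewrite ha -quat_of_CD -quat_of_CN; congr quat_of_C; ring.
  apply/esym; apply: half_sum_split; first exact: (cmc_part_sum (N \o p)).
  exact: (cmc_part_diff (N \o p)).
- by rewrite hmu_p ha hb; exact: par.
(* Passing from mu_+ to mu_- amounts to taking the other square root [- s]. *)
- have -> : mu_m = 1 - 2 * rho + 'i%C * (2 * - s).
    by rewrite hmu_m ha hb; ring.
  by apply: par; rewrite ?oppr_eq0// sqrrN.
Qed.
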